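(* Let $a_0,a_1,a_2,b_0,b_1,b_2\in\mathbb{C}^{\times}$ satisfy $\prod_{i=0}^{2}a_ib_i=-1$, and let $\tau'_{ij}:=\tau^{sf}_{ij}\Theta_{ij}$ for $(i,j)=(1,0),(2,1),(0,2)$, where the matrix-valued functions $\tau^{sf}_{ij}$ and $\Theta_{ij}$ on $U_i\cap U_j\subset\mathbb{P}^2$ are those given in the context. Then on $U_0\cap U_1\cap U_2$ $$\tau'_{02}\,\tau'_{21}\,\tau'_{10}=I .$$
   Context: Let $[\zeta_0:\zeta_1:\zeta_2]$ be homogeneous coordinates on the complex projective plane $\mathbb{P}^2$. For $k=0,1,2$ let $U_k=\{\zeta_k\neq 0\}$, with coordinates $w_k^i:=\zeta_i/\zeta_k$ ($i\neq k$). For constants $a_i,b_i\in\mathbb{C}^{\times}$ define $$\tau^{sf}_{10}=\begin{pmatrix}\frac{a_0}{(w_0^1)^2}&0\\0&\frac{b_0}{w_0^1}\end{pmatrix},\quad \tau^{sf}_{21}=\begin{pmatrix}\frac{b_1}{w_1^2}&0\\0&\frac{a_1}{(w_1^2)^2}\end{pmatrix},\quad \tau^{sf}_{02}=\begin{pmatrix}0&\frac{b_2}{w_2^0}\\\frac{a_2}{(w_2^0)^2}&0\end{pmatrix},$$ $$\Theta_{10}=\begin{pmatrix}1&0\\-a_0b_1a_2\frac{w_0^2}{w_0^1}&1\end{pmatrix},\quad \Theta_{21}=\begin{pmatrix}1&-a_0a_1b_2\frac{w_1^0}{w_1^2}\\0&1\end{pmatrix},\quad \Theta_{02}=\begin{pmatrix}1&0\\-b_0a_1a_2\frac{w_2^1}{w_2^0}&1\end{pmatrix}.$$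 Here $\tau^{sf}_{ij}$ and $\Theta_{ij}$ are functions on $U_i\cap U_j$ with values in invertible $2\times 2$ complex matrices, and $I$ is the $2\times2$ identity matrix. *)

(* Defs.v *)
From HB Require Import structures.
From mathcomp Require Import all_boot all_order all_algebra generic_quotient.
From mathcomp Require Import boolp classical_sets reals.
From mathcomp Require Import complex.

Set Implicit Arguments.
Unset Strict Implicit.
Unset Printing Implicit Defensive.

Import GRing.Theory.

Local Open Scope ring_scope.
Local Open Scope complex_scope.
Local Open Scope quotient_scope.
Local Open Scope classical_set_scope.

Definition homog (R : realType) := {v : 'rV[R[i]]_3 | v != 0}.

Definition proportional (R : realType) : rel (homog R) :=
  fun u v => `[< exists2 c : R[i], c != 0 & val v = c *: val u >].

Lemma proportional_equiv (R : realType) : equiv_class_of (@proportional R).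
Proof.
have symm u v : @proportional R u v -> proportional v u.
  move=> /asboolP[c c0 uv]; apply/asboolP; exists c^-1; rewrite ?invr_eq0 //.
  by rewrite uv scalerA mulVf // scale1r.
split=> [u | u v | v u w].
- by apply/asboolP; exists 1; rewrite ?oner_eq0 // scale1r.
- by apply/idP/idP; apply: symm.
- move=> /asboolP[c c0 uv] /asboolP[d d0 vw]; apply/asboolP.
  by exists (d * c); rewrite ?mulf_neq0 // vw uv scalerA.
Qed.

Canonical proportional_equiv_rel (R : realType) :=
  EquivRelPack (proportional_equiv R).

(* The complex projective plane, R[i] being the field of complex numbers. *)
Definition P2 (R : realType) := {eq_quot (@proportional R)}.

Definition P2_point (R : realType) (v : homog R) : P2 R := \pi_(P2 R) v.

(* Coordinates of a chosen representative: they depend on the choice, but U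
   and w below do not (P2_point_U and P2_point_w). *)
Definition zeta (R : realType) (p : P2 R) (k : 'I_3) : R[i] :=
  val (repr p) 0 k.

Definition U (R : realType) (k : 'I_3) : set (P2 R) :=
  [set p | zeta p k != 0].
Arguments U {R} k.

(* w k i is the coordinate w_k^i = zeta_i / zeta_k, meaningful on U k. *)
Definition w (R : realType) (k i : 'I_3) (p : P2 R) : R[i] :=
  zeta p i / zeta p k.

Lemma zeta_P2_point (R : realType) (v : homog R) :
  exists2 c : R[i], c != 0 & forall k, val v 0 k = c * zeta (P2_point v) k.
Proof.
have : repr (P2_point v) = v %[mod P2 R] by rewrite reprK.
move/eqmodP => /asboolP[c c0 e]; exists c => // k.
by rewrite e mxE.
Qed.

Lemma P2_point_U (R : realType) (v : homog R) (k : 'I_3) :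
  U k (P2_point v) <-> val v 0 k != 0.
Proof.
have [c c0 e] := zeta_P2_point v.
by rewrite /U /= e mulf_eq0 (negbTE c0).
Qed.

Lemma P2_point_w (R : realType) (v : homog R) (k i : 'I_3) :
  w k i (P2_point v) = val v 0 i / val v 0 k.
Proof.
have [c c0 e] := zeta_P2_point v.
by rewrite /w !e -mulf_div divff // mul1r.
Qed.

Definition mx2 (K : fieldType) (x00 x01 x10 x11 : K) : 'M[K]_2 :=
  \matrix_(i, j) (if i == 0 then if j == 0 then x00 else x01
                  else if j == 0 then x10 else x11).

Lemma mx2_unit (K : fieldType) (x00 x01 x10 x11 : K) :
  (mx2 x00 x01 x10 x11 \in unitmx) = (x00 * x11 - x01 * x10 != 0).
Proof.
rewrite unitmxE unitfE (expand_det_row _ 0) !big_ord_recl big_ord0 addr0.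
rewrite /cofactor !det_mx11 !mxE /= expr0 mul1r.
by rewrite /bump /= addn0 expr1 mulN1r mulrN.
Qed.

Section TransitionFunctions.
Variables (R : realType) (a b : 'I_3 -> R[i]).
Implicit Type p : P2 R.

(* Total functions on P2; the transition function with indices i, j is
   meaningful on U i `&` U j only. *)
Definition tau_sf10 p := mx2 (a 0 / w 0 1 p ^+ 2) 0
                             0                    (b 0 / w 0 1 p).
Definition tau_sf21 p := mx2 (b 1 / w 1 2 p) 0
                             0               (a 1 / w 1 2 p ^+ 2).
Definition tau_sf02 p := mx2 0                    (b 2 / w 2 0 p)
                             (a 2 / w 2 0 p ^+ 2) 0.

Definition Theta10 p := mx2 1                                          0
                            (- (a 0 * b 1 * a 2) * (w 0 2 p / w 0 1 p)) 1.
Definition Theta21 p := mx2 1 (- (a 0 * a 1 * b 2) * (w 1 0 p / w 1 2 p))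
                            0 1.
Definition Theta02 p := mx2 1                                          0
                            (- (b 0 * a 1 * a 2) * (w 2 1 p / w 2 0 p)) 1.

Definition tau'10 p := tau_sf10 p *m Theta10 p.
Definition tau'21 p := tau_sf21 p *m Theta21 p.
Definition tau'02 p := tau_sf02 p *m Theta02 p.

Hypotheses (ha : forall i, a i != 0) (hb : forall i, b i != 0).

Let w_neq0 k i p : U k p -> U i p -> w k i p != 0.
Proof. by rewrite /U /w /= => pk pi; rewrite mulf_neq0 ?invr_neq0. Qed.

Lemma tau'10_unit p : (U 1 `&` U 0) p ->
  [/\ tau_sf10 p \in unitmx, Theta10 p \in unitmx & tau'10 p \in unitmx].
Proof.
case=> p1 p0; have w0 := w_neq0 p0 p1.
have t : tau_sf10 p \in unitmx.
  by rewrite mx2_unit mul0r subr0 !mulf_neq0 ?invr_neq0 ?expf_neq0.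
have T : Theta10 p \in unitmx.
  by rewrite mx2_unit mul0r subr0 mul1r oner_eq0.
by split=> //; rewrite unitmx_mul t.
Qed.

Lemma tau'21_unit p : (U 2 `&` U 1) p ->
  [/\ tau_sf21 p \in unitmx, Theta21 p \in unitmx & tau'21 p \in unitmx].
Proof.
case=> p2 p1; have w0 := w_neq0 p1 p2.
have t : tau_sf21 p \in unitmx.
  by rewrite mx2_unit mul0r subr0 !mulf_neq0 ?invr_neq0 ?expf_neq0.
have T : Theta21 p \in unitmx.
  by rewrite mx2_unit mulr0 subr0 mul1r oner_eq0.
by split=> //; rewrite unitmx_mul t.
Qed.

Lemma tau'02_unit p : (U 0 `&` U 2) p ->
  [/\ tau_sf02 p \in unitmx, Theta02 p \in unitmx & tau'02 p \in unitmx].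
Proof.
case=> p0 p2; have w0 := w_neq0 p2 p0.
have t : tau_sf02 p \in unitmx.
  by rewrite mx2_unit mul0r sub0r oppr_eq0 !mulf_neq0 ?invr_neq0 ?expf_neq0.
have T : Theta02 p \in unitmx.
  by rewrite mx2_unit mul0r subr0 mul1r oner_eq0.
by split=> //; rewrite unitmx_mul t.
Qed.

End TransitionFunctions.

(* Main.v *)
Require Import Defs.
From mathcomp Require Import all_boot all_order all_algebra.
From mathcomp Require Import boolp classical_sets reals.
From mathcomp Require Import complex.
From mathcomp Require Import ring.

Import GRing.Theory.

Local Open Scope ring_scope.
Local Open Scope complex_scope.
Local Open Scope classical_set_scope.

(** In homogeneous coordinates everything is an explicit 2x2 product. The (0,1) entry of
    [tau'02 *m tau'21] is a multiple of 1 + a0 b0 a1 b1 a2 b2, so the hypothesis kills it; the same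
    relation turns the diagonal into the inverse of that of [tau'10]. The remaining (1,0) terms
    cancel. *)

Lemma mx2M (K : fieldType) (x00 x01 x10 x11 y00 y01 y10 y11 : K) :
  mx2 x00 x01 x10 x11 *m mx2 y00 y01 y10 y11 =
  mx2 (x00 * y00 + x01 * y10) (x00 * y01 + x01 * y11)
      (x10 * y00 + x11 * y10) (x10 * y01 + x11 * y11).
Proof.
apply/matrixP => i j; rewrite !mxE big_ord_recl big_ord1 !mxE /=.
by case: (i == 0); case: (j == 0).
Qed.

Lemma mx2_id (K : fieldType) : mx2 1 0 0 1 = 1%:M :> 'M[K]_2.
Proof. by apply/matrixP => -[[|[|//]] ?] [[|[|//]] ?]; rewrite !mxE. Qed.

Lemma prod_ord3 (K : comNzRingType) (f : 'I_3 -> K) :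
  \prod_(i < 3) f i = f 0 * f 1 * f 2.
Proof.
rewrite !big_ord_recl big_ord0 mulr1 mulrA.
(* The recursion yields iterated lifts of [ord0], which agree with the literals [1] and [2] only
   through their values. *)
by congr (f _ * f _ * f _); apply: val_inj.
Qed.

Theorem proposition3p7 (R : realType) (a b : 'I_3 -> R[i])
    (ha : forall i, a i != 0) (hb : forall i, b i != 0)
    (hab : \prod_(i < 3) (a i * b i) = -1) :
  forall p : P2 R, (U 0 `&` U 1 `&` U 2) p ->
    tau'02 a b p *m tau'21 a b p *m tau'10 a b p = 1%:M.
Proof.
move=> p [[]]; rewrite /U /= => z0 z1 z2.
move: hab; rewrite prod_ord3 => {}hab.
rewrite /tau'02 /tau'21 /tau'10 /tau_sf02 /tau_sf21 /tau_sf10.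
rewrite /Theta02 /Theta21 /Theta10 /w !mx2M -mx2_id.
move: z0 z1 z2 hab.
(* Nothing about [p] matters beyond its nonzero coordinates, so nine field variables suffice. *)
move: (zeta p 0) (zeta p 1) (zeta p 2) (a 0) (a 1) (a 2) (b 0) (b 1) (b 2).
move=> x y z a0 a1 a2 b0 b1 b2 x0 y0 z0 hab.
(* Each entry is a rational identity modulo [hab]; only the coordinates occur in denominators. *)
by congr mx2; field: hab; rewrite x0 y0 z0.
Qed.
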